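(* Let $\mathfrak M=(\mathcal M,\rho)$ be a finite pseudometric space. Let $\mathfrak T$ be either the family of all non-empty convex compact subsets of $\mathbf R^2$ or the family of all closed half-planes in $\mathbf R^2$, and let $F:\mathcal M\to\mathfrak T$ be a set-valued mapping. If $\Lambda^{(\mathcal{FP})}(F)=+\infty$ (in which case the Iterative Algorithm produces the outcome ''No go''), then $F$ does not have a Lipschitz selection. Otherwise, given a constant $\lambda\in[\Lambda^{(\mathcal{FP})}(F),+\infty)$, the $(\lambda;F)$-Iterative Algorithm produces the outcome ''Success'' and returns the mapping $f^{[\lambda;F]}:\mathcal M\to\mathbf R^2$, which has the following properties: ($\bigstar\mathscr A$) The mapping $f^{[\lambda;F]}$ is well defined, that is: (i) for every $x\in\mathcal M$, the sets $F^{[1]}[x:\lambda]$ and $F^{[2]}[x:\lambda,3\lambda]$ are non-empty; (ii) for every $x\in\mathcal M$ the rectangle $\Pi_{\lambda,F}(x)$ is a non-empty bounded subset of $\mathbf R^2$. ($\bigstar\mathscr B$) $f^{[\lambda;F]}$ is a Lipschitz selection of $F$ with $\|f^{[\lambda;F]}\|_{\mathrm{Lip}(\mathcal M)}\le\gamma\lambda$, where $\gamma=420$.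
   Context: A pseudometric space $\mathfrak M=(\mathcal M,\rho)$ is a set with $\rho:\mathcal M\times\mathcal M\to[0,+\infty]$ such that $\rho(x,x)=0$, $\rho(x,y)=\rho(y,x)$, $\rho(x,y)\le\rho(x,z)+\rho(z,y)$; $\rho(x,y)=0$ with $x\ne y$ and $\rho(x,y)=+\infty$ are allowed. We read $\lambda\cdot(+\infty)=+\infty$ for every $\lambda\ge0$ and $(+\infty)Q_0=\mathbf R^2$. $\mathbf R^2$ carries the uniform norm $\|x\|=\max\{|x_1|,|x_2|\}$; $Q_0=[-1,1]^2$; $Q(a,r)=\{y:\|y-a\|\le r\}$; $\operatorname{dist}$ is the distance in this norm; sums of sets are Minkowski sums. For $\mathcal M'\subset\mathcal M$ and $f:\mathcal M'\to\mathbf R^2$, $\|f\|_{\mathrm{Lip}(\mathcal M')}=\inf\{\lambda\ge0:\|f(x)-f(y)\|\le\lambda\rho(x,y)\ \forall x,y\in\mathcal M'\}$ ($\inf\emptyset=+\infty$); $f$ is Lipschitz if this is finite. A selection of $F|_{\mathcal M'}$ is a map $f:\mathcal M'\to\mathbf R^2$ with $f(x)\in F(x)$ for all $x\in\mathcal M'$. For a convex set $S$, the rectangular hull $\mathcal H[S]$ is the product of the orthogonal projections of $S$ onto the two coordinate axes (the smallest axis-parallel rectangle containing $S$); $\mathrm{center}$ denotes the center of a bounded rectangle. $\Lambda^{(\mathcal{FP})}(F)$ is the infimum of all $\lambda\ge0$ such that for every $\mathcal M'\subset\mathcal M$ consisting of at most four points, $F|_{\mathcal M'}$ has a Lipschitz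 selection $f_{\mathcal M'}$ with $\|f_{\mathcal M'}\|_{\mathrm{Lip}(\mathcal M')}\le\lambda$; it is $+\infty$ if no such $\lambda$ exists. The $(\lambda;F)$-Iterative Algorithm: if $\Lambda^{(\mathcal{FP})}(F)=+\infty$, the outcome is ''No go''. Otherwise, for the given $\lambda\in[\Lambda^{(\mathcal{FP})}(F),+\infty)$ and all $x\in\mathcal M$, put $$F^{[1]}[x:\lambda]=\bigcap_{z\in\mathcal M}\{F(z)+\lambda\rho(x,z)Q_0\},\qquad F^{[2]}[x:\lambda,3\lambda]=\bigcap_{z\in\mathcal M}\{F^{[1]}[z:\lambda]+3\lambda\rho(x,z)Q_0\},$$ $$r_x=\operatorname{dist}(0,F^{[2]}[x:\lambda,3\lambda]),\qquad\mathscr F[x:\lambda]=F^{[2]}[x:\lambda,3\lambda]\cap Q(0,2r_x),$$ $$\Pi_{\lambda,F}(x)=\mathcal H[\mathscr F[x:\lambda]],\qquad f^{[\lambda;F]}(x)=\mathrm{center}(\Pi_{\lambda,F}(x)),$$ and the outcome is ''Success''. *)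

(* Defs.v *)
From mathcomp Require Import all_boot all_order all_algebra.
From mathcomp Require Import all_classical all_reals all_analysis.

Set Implicit Arguments.
Unset Strict Implicit.
Unset Printing Implicit Defensive.

Import Order.TTheory GRing.Theory Num.Theory.
Import numFieldNormedType.Exports.

Local Open Scope classical_set_scope.
Local Open Scope ring_scope.
Local Open Scope ereal_scope.

Record is_pseudometric (R : realType) (M : Type) (rho : M -> M -> \bar R) :
    Prop := IsPseudometric {
  pseudometric_ge0 : forall x y, 0 <= rho x y ;
  pseudometric_refl : forall x, rho x x = 0 ;
  pseudometric_sym : forall x y, rho x y = rho y x ;
  pseudometric_triangle : forall x y z, rho x y <= rho x z + rho z y }.

(* The norm of the product module R * R is the uniform norm (prod_normE). *)
Notation plane R := (R * R)%type (only parsing).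

(* Unlike the multiplication of \bar R, for which 0 * +oo = 0, this product
   satisfies l * +oo = +oo for every l >= 0. *)
Definition scale_dist (R : realType) (l : R) (t : \bar R) : \bar R :=
  if t == +oo then +oo else l%:E * t.

Section Plane.
Context {R : realType}.
Implicit Types (A B S : set (plane R)) (a p : plane R).

Definition convex_compacts : set (set (plane R)) :=
  [set S | [/\ S !=set0, convex_set (M := plane R) S & compact S]].

Definition closed_half_planes : set (set (plane R)) :=
  [set S | exists (n : plane R) (c : R), n != 0%R /\
     S = [set p | (n.1 * p.1 + n.2 * p.2 <= c)%R]].

Definition minkowski_sum A B : set (plane R) :=
  [set (p + q)%R | p in A & q in B].

Definition Q0 : set (plane R) := `[(-1)%R, 1%R] `*` `[(-1)%R, 1%R].

(* The value at -oo is irrelevant: only multiples t >= 0 are used. *)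
Definition dilate_Q0 (t : \bar R) : set (plane R) :=
  match t with
  | r%:E => [set (r *: q)%R | q in Q0]
  | +oo => setT
  | -oo => set0
  end.

Definition square a (r : R) : set (plane R) := [set y | (`|y - a| <= r)%R].

(* Meaningful for S nonempty; inf set0 = 0. *)
Definition dist p S : R := inf [set `|p - s|%R | s in S].

Definition rect_hull S : set (plane R) := (fst @` S) `*` (snd @` S).

(* Meaningful for a nonempty bounded rectangle S. *)
Definition center S : plane R :=
  (((inf (fst @` S) + sup (fst @` S)) / 2)%R,
   ((inf (snd @` S) + sup (snd @` S)) / 2)%R).

End Plane.

Inductive outcome (R : realType) (M : Type) : Type :=
| NoGo
| Success of (M -> plane R).
Arguments NoGo {R M}.

Section Selections.
Context {R : realType} {M : finType}.
Variables (rho : M -> M -> \bar R) (F : M -> set (plane R)).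

(* Maps on a subset M' are represented by total maps, of which only the values
   on M' matter. *)
Definition lip_norm (M' : {set M}) (f : M -> plane R) : \bar R :=
  ereal_inf [set l%:E | l in [set l : R | (0 <= l)%R /\
    {in M' &, forall x y, `|f x - f y|%:E <= scale_dist l (rho x y)}]].

Definition lipschitz_selection (M' : {set M}) (f : M -> plane R) : Prop :=
  {in M', forall x, F x (f x)} /\ lip_norm M' f < +oo.

Definition LambdaFP : \bar R :=
  ereal_inf [set l%:E | l in [set l : R | (0 <= l)%R /\
    forall M' : {set M}, (#|M'| <= 4)%N ->
      exists f, lipschitz_selection M' f /\ lip_norm M' f <= l%:E]].

Definition refinement (G : M -> set (plane R)) (l : R) (x : M) :
    set (plane R) :=
  \bigcap_(z in [set: M])
    minkowski_sum (G z) (dilate_Q0 (scale_dist l (rho x z))).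

Section Algorithm.
Variable lam : R.

Definition F1 : M -> set (plane R) := refinement F lam.

Definition F2 : M -> set (plane R) := refinement F1 (3 * lam)%R.

Definition truncatedF2 (x : M) : set (plane R) :=
  F2 x `&` square 0%R (2 * dist 0%R (F2 x))%R.

Definition alg_rect (x : M) : set (plane R) := rect_hull (truncatedF2 x).

Definition alg_map (x : M) : plane R := center (alg_rect x).

Definition iterative_algorithm : outcome R M :=
  if LambdaFP == +oo then NoGo else Success alg_map.

End Algorithm.
End Selections.

(* Main.v *)
Require Import Defs.
From mathcomp Require Import all_boot all_order all_algebra.
From mathcomp Require Import all_classical all_reals all_analysis.
From mathcomp Require Import ring lra.
Import Order.TTheory GRing.Theory Num.Theory.
Import numFieldNormedType.Exports.
Local Open Scope classical_set_scope.
Local Open Scope ring_scope.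

(** Fix lambda and write D := lambda * rho; the points at infinite distance
from a given point impose no constraint on it, so D may be taken finite.  The
idea is to show that F2 is nonempty and that F2 is Lipschitz for the Hausdorff
distance with constant 15 lambda; the rest is elementary.

Two facts make four points enough.  The plane carries the uniform norm, so a
map which is 1-Lipschitz for D on a few points extends to all points with the
same constant ([mcshane]).  And the plane has Helly number 3, so a statement
about F1 z, an intersection of thickened sets [shell z u], only has to be
checked on two or three indices u at a time.

Nonemptiness of F2 x amounts, by Helly, to finding for three points z1, z2, z3
a point within 3 D x z_i of each F1 z_i ([refine2_meet3]).  Taken directly,
this would involve six sets of the family F.  Instead Helly is applied three
times, centred at z2, then at z1, then at z3; each application keeps only one
or two of the sets around its center, and what remains in the end are
configurations of at most four sets, which a selection on four points settles.
The result ([refine1_triple]) is a point of F1 z2 within D z2 z1 of F1 z1 and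
within D z2 z1 + D z1 z3 of F1 z3, and as squares have Helly number 2, this is
enough when z3 is the farthest from x.

For the Hausdorff estimate ([refine2_lipschitz]), take p in F2 x.  By Helly it
is enough to meet, for two points z1 and z2, the square around p and the two
sets thickening F1 z1 and F1 z2 about y.  The definition of F2 x gives points
of F1 z1 and F1 z2 near p which are slightly too far from each other; another
use of Helly gives two such points as close as D z1 z2 allows, and not too far
from p ([refine1_close_near]).  The factor 3 in the definition of F2 leaves room
between the two pairs, and a convex combination of them works.

Truncating two convex sets by squares of twice their distance to the origin
multiplies their Hausdorff distance by at most 10 ([truncate_hausdorff]), and
the center of the bounding rectangle is 1-Lipschitz for the Hausdorff distance
([center_lipschitz]).  Altogether the constant is 10 * 15 = 150 <= 420.  The
center lies in the set because, in the plane, a convex set touching the four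
sides of its bounding rectangle contains the center of the latter ([center_in]).

Lastly, lambda may be equal to the infimum that defines LambdaFP, so that
selections on four points are only given for constants larger than lambda.
For compact sets a minimizing selection exists by compactness
([compacts_attained]); for half-planes the selections are the solutions of a
finite linear system, whose solvability is a closed condition on the right-hand
side, by Fourier-Motzkin elimination ([half_planes_attained]). *)

Set Implicit Arguments.
Unset Strict Implicit.
Unset Printing Implicit Defensive.

(** * Radon and Helly in the plane *)

Definition convex (R : realType) (S : set (plane R)) : Prop :=
  forall p q (t : R), S p -> S q -> 0 <= t <= 1 -> S (t *: p + (1 - t) *: q).

Definition meet3 (R : realType) (A B C : set (plane R)) : Prop :=
  exists p, [/\ A p, B p & C p].

Section Helly.
Context {R : realType}.
Implicit Types (A B C D S X Y : set (plane R)) (p q : plane R).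

Lemma convexI A B : convex A -> convex B -> convex (A `&` B).
Proof.
by move=> cA cB p q t [Ap Bp] [Aq Bq] ht; split; [exact: cA|exact: cB].
Qed.

Lemma convex_sum S (I : finType) (w : I -> R) (p : I -> plane R) :
  convex S -> (forall i, 0 <= w i) -> \sum_i w i = 1 ->
  (forall i, w i != 0 -> S (p i)) -> S (\sum_i w i *: p i).
Proof.
move=> cS w0 w1 Sp.
have gen (s : seq I) : \sum_(i <- s) w i != 0 ->
    S ((\sum_(i <- s) w i)^-1 *: \sum_(i <- s) w i *: p i).
  elim: s => [|i s IH]; first by rewrite big_nil eqxx.
  rewrite !big_cons.
  have s0 : 0 <= \sum_(j <- s) w j by apply: sumr_ge0.
  have [wi0|wi0] := eqVneq (w i) 0; first by rewrite wi0 scale0r !add0r.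
  have wi_gt0 : 0 < w i by rewrite lt_def wi0 w0.
  have [ws0|ws0] := eqVneq (\sum_(j <- s) w j) 0.
    have -> : \sum_(j <- s) w j *: p j = 0.
      rewrite big_seq big1// => j js; move/eqP: ws0.
      rewrite psumr_eq0//.
      by move/allP => /(_ _ js) /eqP->; rewrite scale0r.
    by move=> _; rewrite ws0 !addr0 scalerA mulVf// scale1r; exact: Sp.
  move=> wne; set a := w i; set b := \sum_(j <- s) w j.
  have Sq := IH ws0; set q := _ *: _ in Sq.
  have b_gt0 : 0 < b by rewrite lt_def ws0 s0.
  have -> : (a + b)^-1 *: (a *: p i + \sum_(j <- s) w j *: p j) =
      (a / (a + b)) *: p i + (1 - a / (a + b)) *: q.
    rewrite scalerDr !scalerA mulrC; congr (_ + _); congr (_ *: _).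
    by rewrite -/b; field; rewrite !gt_eqF// addr_gt0.
  apply: cS => //; first exact: Sp.
  rewrite divr_ge0/= ?ler_pdivrMr ?addr_gt0// ?mul1r ?lerDl// ?addr_ge0//;
    by rewrite ?ltW.
by have := gen (index_enum I); rewrite w1 invr1 scale1r; apply;
  exact: oner_neq0.
Qed.

(** The rows (1, x, y) of four points form a matrix of rank at most 3. *)
Lemma affine_dependence (p : 'I_4 -> plane R) :
  exists c : 'I_4 -> R,
    [/\ exists i, c i != 0, \sum_i c i = 0 & \sum_i c i *: p i = 0].
Proof.
pose A : 'M[R]_(4, 3) := \matrix_(i, j)
  (if j == 0 then 1 else if j == 1 then (p i).1 else (p i).2).
have kA : kermx A != 0.
  rewrite kermx_eq0 /row_free; apply/negP => /eqP rA.
  by have := rank_leq_col A; rewrite rA.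
pose v := nz_row (kermx A).
have vA : v *m A = 0 by apply/sub_kermxP; exact: nz_row_sub.
have vn : v != 0 by rewrite nz_row_eq0.
have vAj j : \sum_i v 0 i * A i j = 0.
  by have := congr1 (fun M : 'rV[R]_3 => M 0 j) vA; rewrite !mxE.
exists (v 0); split.
- have [i vi] : exists i, v 0 i != 0; last by exists i.
  apply/existsP; move: vn; apply: contraNT; rewrite negb_exists => /forallP vz.
  by apply/eqP/rowP => i; rewrite mxE; apply/eqP; have := vz i; rewrite negbK.
- by rewrite -[RHS](vAj 0); apply: eq_bigr => i _; rewrite mxE eqxx mulr1.
- rewrite [LHS]surjective_pairing !raddf_sum/=.
  congr pair.
  + rewrite -[RHS](vAj 1); apply: eq_bigr => i _; rewrite mxE/=.
    by [].
  + rewrite -[RHS](vAj 2%:R); apply: eq_bigr => i _; rewrite mxE/=.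
    by [].
Qed.

(** The positive and the negative part of an affine dependence, normalized. *)
Lemma radon (p : 'I_4 -> plane R) :
  exists w w' : 'I_4 -> R,
    [/\ (forall i, 0 <= w i) /\ (forall i, 0 <= w' i),
        \sum_i w i = 1, \sum_i w' i = 1,
        \sum_i w i *: p i = \sum_i w' i *: p i
      & forall i, w i = 0 \/ w' i = 0].
Proof.
have [c [[i0 ci0] c1 cp]] := affine_dependence p.
pose a i := Num.max (c i) 0; pose b i := Num.max (- c i) 0.
have a0 i : 0 <= a i by rewrite /a le_max lexx orbT.
have b0 i : 0 <= b i by rewrite /b le_max lexx orbT.
have abc i : a i - b i = c i.
  rewrite /a /b; case: (lerP 0 (c i)) => h.
    by rewrite max_r ?oppr_le0// subr0.
  by rewrite max_l ?opprK ?add0r// oppr_ge0 ltW.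
have Sab : \sum_i a i = \sum_i b i.
  apply/eqP; rewrite -subr_eq0 -sumrB; under eq_bigr do rewrite abc.
  by rewrite c1.
have Sne : \sum_i a i != 0.
  apply/negP => Sa; have Sb : \sum_i b i == 0 by rewrite -Sab.
  move: Sa Sb; rewrite !psumr_eq0//.
  move=> /allP/(_ i0) + /allP/(_ i0).
  rewrite mem_index_enum => /(_ isT)/eqP ai /(_ isT)/eqP bi.
  by move: ci0; rewrite -abc ai bi subrr eqxx.
have S0 : 0 < \sum_i a i by rewrite lt_def Sne sumr_ge0.
exists (fun i => (\sum_i a i)^-1 * a i), (fun i => (\sum_i a i)^-1 * b i).
split.
- by split=> i; rewrite mulr_ge0// invr_ge0 ltW.
- by rewrite -mulr_sumr mulVf.
- by rewrite -mulr_sumr -Sab mulVf.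
- under eq_bigr do rewrite -scalerA; under [RHS]eq_bigr do rewrite -scalerA.
  rewrite -!scaler_sumr; congr (_ *: _); apply/eqP; rewrite -subr_eq0 -sumrB.
  by under eq_bigr do rewrite -scalerBl abc; rewrite cp.
- move=> i; rewrite /a /b; case: (lerP 0 (c i)) => h; [right|left].
    by rewrite max_r ?mulr0// oppr_le0.
  by rewrite mulr0.
Qed.

(** The Radon point of four points, the k-th of which lies in the three sets
other than the k-th one, is a combination of points of each of the sets. *)
Lemma helly4 A B C D : convex A -> convex B -> convex C -> convex D ->
  meet3 B C D -> meet3 A C D -> meet3 A B D -> meet3 A B C ->
  exists p, [/\ A p, B p, C p & D p].
Proof.
move=> cA cB cC cD [pA hA] [pB hB] [pC hC] [pD hD].
pose p (i : 'I_4) := nth 0 [:: pA; pB; pC; pD] i.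
have [w [w' [[w0 w'0] w1 w'1 ww' disj]]] := radon p.
have key (S : set (plane R)) (k : 'I_4) : convex S ->
    (forall i, i != k -> S (p i)) -> S (\sum_i w i *: p i).
  move=> cS Sp; have [wk|wk] := disj k; last rewrite ww';
    apply: convex_sum => // i wi; apply: Sp;
    by apply: contraNneq wi => ->; rewrite wk.
exists (\sum_i w i *: p i); split.
- apply: (key _ 0 cA) => -[[|[|[|[|//]]]] ?]//= _; rewrite /p/=.
  + by case: hB. + by case: hC. + by case: hD.
- apply: (key _ 1 cB) => -[[|[|[|[|//]]]] ?]//= _; rewrite /p/=.
  + by case: hA. + by case: hC. + by case: hD.
- apply: (key _ 2%:R cC) => -[[|[|[|[|//]]]] ?]//= _; rewrite /p/=.
  + by case: hA. + by case: hB. + by case: hD.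
- apply: (key _ 3%:R cD) => -[[|[|[|[|//]]]] ?]//= _; rewrite /p/=.
  + by case: hA. + by case: hB. + by case: hC.
Qed.

(** Intersecting all the other sets with the first one preserves the hypothesis,
by [helly4], and shortens the family. *)
Lemma helly_seq (I : eqType) (s : seq I) (S : I -> set (plane R)) :
  (forall i, convex (S i)) ->
  (forall i j k, i \in s -> j \in s -> k \in s -> meet3 (S i) (S j) (S k)) ->
  exists p, forall i, i \in s -> S i p.
Proof.
elim: s S => [|a [|b s] IH] S cS S3; first by exists 0.
  have mem_a := mem_head a [::].
  have [p [ap _ _]] := S3 a a a mem_a mem_a mem_a.
  by exists p => i; rewrite inE => /eqP->.
have cS' i : convex (S a `&` S i) by exact: convexI.
have [i j k si sj sk|p hp] := IH (fun i => S a `&` S i) cS'.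
  have [||||p [ap ip jp kp]] := helly4 (cS a) (cS i) (cS j) (cS k);
    try by apply: S3; rewrite ?mem_head// in_cons ?si ?sj ?sk orbT.
  by exists p.
exists p => i; rewrite in_cons => /orP[/eqP->|si].
  by have [] := hp b (mem_head _ _).
by have [] := hp i si.
Qed.

Lemma helly (I : finType) (S : I -> set (plane R)) :
  (forall i, convex (S i)) -> (forall i j k, meet3 (S i) (S j) (S k)) ->
  exists p, forall i, S i p.
Proof.
move=> cS S3; have [//|p hp] := @helly_seq I (enum I) S cS.
by exists p => i; apply: hp; rewrite mem_enum.
Qed.

(** Helly for the traces of the family on X, whose triples meet by [helly4]. *)
Lemma helly_extra1 (I : finType) (i0 : I) (S : I -> set (plane R)) X :
  (forall i, convex (S i)) -> convex X ->
  (forall i j k, meet3 (S i) (S j) (S k)) ->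
  (forall i j, meet3 X (S i) (S j)) ->
  exists p, X p /\ forall i, S i p.
Proof.
move=> cS cX S3 X2.
have [i|i j k|p hp] := @helly I (fun i => X `&` S i); first exact: convexI.
  have [||||p [Xp ip jp kp]] := helly4 cX (cS i) (cS j) (cS k) => //.
  by exists p.
by exists p; split=> [|i]; [case: (hp i0)|case: (hp i)].
Qed.

Lemma helly_extra2 (I : finType) (i0 : I) (S : I -> set (plane R)) X Y :
  (forall i, convex (S i)) -> convex X -> convex Y ->
  (forall i j k, meet3 (S i) (S j) (S k)) ->
  (forall i j, meet3 X (S i) (S j)) -> (forall i j, meet3 Y (S i) (S j)) ->
  (forall i, meet3 X Y (S i)) ->
  exists p, [/\ X p, Y p & forall i, S i p].
Proof.
move=> cS cX cY S3 X2 Y2 XY.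
have [i|//|i j k|i j|p [Xp hp]] :=
    @helly_extra1 I i0 (fun i => Y `&` S i) X; first exact: convexI.
- have [||||p [Yp ip jp kp]] := helly4 cY (cS i) (cS j) (cS k) => //.
  by exists p.
- have [||||p [Xp Yp ip jp]] := helly4 cX cY (cS i) (cS j) => //.
  by exists p.
- by exists p; split=> [//||i]; [case: (hp i0)|case: (hp i)].
Qed.

End Helly.

(** * Thickenings and squares *)

Section Plane.
Context {R : realType}.
Implicit Types (A B S : set (plane R)) (p q a b : plane R) (r t : R).

Lemma norm_planeE p : `|p| = Num.max `|p.1| `|p.2|.
Proof. by []. Qed.

Lemma norm_plane_le p r : (`|p| <= r) = (`|p.1| <= r) && (`|p.2| <= r).
Proof. by rewrite norm_planeE ge_max. Qed.

(** For r >= 0, the Minkowski sum of A and the square r Q0. *)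
Definition thicken A r : set (plane R) :=
  [set y | exists2 a, A a & `|y - a| <= r].

Lemma thickenW A r r' p : r <= r' -> thicken A r p -> thicken A r' p.
Proof. by move=> rr' [a Aa pa]; exists a => //; exact: le_trans rr'. Qed.

Lemma conv_diag p t : t *: p + (1 - t) *: p = p.
Proof. by rewrite -scalerDl addrC subrK scale1r. Qed.

Lemma dist_conv p q a b t : 0 <= t <= 1 ->
  `|t *: p + (1 - t) *: q - (t *: a + (1 - t) *: b)|
    <= t * `|p - a| + (1 - t) * `|q - b|.
Proof.
move=> /andP[t0 t1]; rewrite opprD addrACA -!scalerBr.
by apply: (le_trans (ler_normD _ _)); rewrite !normrZ !ger0_norm// subr_ge0.
Qed.

Lemma convex_thicken A r : convex A -> convex (thicken A r).
Proof.
move=> cA p q t [a Aa pa] [b Ab qb] /[dup] t01 /andP[t0 t1].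
exists (t *: a + (1 - t) *: b); first exact: cA.
apply: (le_trans (dist_conv _ _ _ _ t01)).
have : t * `|p - a| <= t * r by rewrite ler_wpM2l.
have : (1 - t) * `|q - b| <= (1 - t) * r by rewrite ler_wpM2l// subr_ge0.
by lra.
Qed.

Lemma convex_ball p r : convex [set y | `|y - p| <= r].
Proof.
have -> : [set y | `|y - p| <= r] = thicken [set p] r.
  by apply/seteqP; split=> y /=; [exists p|case=> _ -> ].
by apply: convex_thicken => _ _ t -> -> _; exact: conv_diag.
Qed.

Lemma interval3 (a1 a2 a3 r1 r2 r3 : R) : 0 <= r1 -> 0 <= r2 -> 0 <= r3 ->
  `|a1 - a2| <= r1 + r2 -> `|a1 - a3| <= r1 + r3 -> `|a2 - a3| <= r2 + r3 ->
  exists m, [/\ `|m - a1| <= r1, `|m - a2| <= r2 & `|m - a3| <= r3].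
Proof.
move=> h1 h2 h3; rewrite !ler_norml => /andP[? ?] /andP[? ?] /andP[? ?].
exists (Num.max (a1 - r1) (Num.max (a2 - r2) (a3 - r3))).
by split; rewrite ler_norml; apply/andP; split;
  case: (leP (a2 - r2)) => ?; case: (leP (a1 - r1)) => ?; lra.
Qed.

(** Squares have Helly number 2, as the two coordinates are independent. *)
Lemma square3 (a1 a2 a3 : plane R) (r1 r2 r3 : R) :
  0 <= r1 -> 0 <= r2 -> 0 <= r3 ->
  `|a1 - a2| <= r1 + r2 -> `|a1 - a3| <= r1 + r3 -> `|a2 - a3| <= r2 + r3 ->
  exists m, [/\ `|m - a1| <= r1, `|m - a2| <= r2 & `|m - a3| <= r3].
Proof.
move=> h1 h2 h3; rewrite !norm_plane_le.
move=> /andP[x12 y12] /andP[x13 y13] /andP[x23 y23].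
have [x [? ? ?]] := interval3 h1 h2 h3 x12 x13 x23.
have [y [? ? ?]] := interval3 h1 h2 h3 y12 y13 y23.
by exists (x, y); rewrite !norm_plane_le; split; apply/andP; split.
Qed.

End Plane.

(** * The two refinements of a set-valued map *)

Section Refinements.
Context {R : realType} {N : finType}.
Variables (D : N -> N -> R) (F : N -> set (plane R)).
Hypothesis D0 : forall x, D x x = 0.
Hypothesis Dsym : forall x y, D x y = D y x.
Hypothesis Dtri : forall x y z, D x y <= D x z + D z y.
Hypothesis cF : forall x, convex (F x).
Hypothesis FP4 : forall a b c d, exists f : N -> plane R,
  (forall x y, `|f x - f y| <= D x y) /\
  [/\ F a (f a), F b (f b), F c (f c) & F d (f d)].

Let D_ge0 x y : 0 <= D x y.
Proof. by have := Dtri x x y; rewrite D0 (Dsym y x); lra. Qed.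

Definition shell z u := thicken (F u) (D z u).
(** With D = lambda * rho, these are the sets F1 and F2 of the algorithm. *)
Definition refine1 z : set (plane R) := [set y | forall u, shell z u y].
Definition refine2 x : set (plane R) :=
  [set y | forall z, thicken (refine1 z) (3 * D x z) y].

Lemma convex_shell z u : convex (shell z u).
Proof. exact: convex_thicken. Qed.
Arguments convex_shell : clear implicits.

Lemma convex_refine1 z : convex (refine1 z).
Proof. by move=> p q t hp hq t01 u; exact: convex_shell. Qed.

Lemma convex_refine2 x : convex (refine2 x).
Proof.
by move=> p q t hp hq t01 z; apply: convex_thicken => //; exact: convex_refine1.
Qed.

Lemma shell3 z u v w : meet3 (shell z u) (shell z v) (shell z w).
Proof.
have [f [fL [fu fv fw _]]] := FP4 u v w w.
by exists (f z); split; [exists (f u)|exists (f v)|exists (f w)].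
Qed.

(** The pair of indices of z and a pair of indices at z' make four points; a
selection f on them gives f z and f z', at distance at most D z z'. *)
Lemma near_refine1_shell2 z z' u u' :
  meet3 (thicken (refine1 z') (D z z')) (shell z u) (shell z u').
Proof.
have cX : convex (thicken (shell z u `&` shell z u') (D z z')).
  by apply: convex_thicken; apply: convexI; exact: convex_shell.
have [v v'|y [[x [xu xu'] yx] yC]] :=
    helly_extra1 z (convex_shell z') cX (@shell3 z').
  have [f [fL [fu fu' fv fv']]] := FP4 u u' v v'.
  exists (f z'); split; [|by exists (f v)|by exists (f v')].
  exists (f z); last by rewrite Dsym.
  by split; [exists (f u)|exists (f u')].
by exists x; split=> //; exists y => //; rewrite distrC.
Qed.

Lemma refine1_close z z' :
  exists2 c, refine1 z c & thicken (refine1 z') (D z z') c.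
Proof.
have [//|||c [cX cC]] :=
    helly_extra1 (X := thicken (refine1 z') (D z z')) z (convex_shell z).
- by apply: convex_thicken; exact: convex_refine1.
- exact: shell3.
- exact: near_refine1_shell2.
by exists c.
Qed.

(** Helly at z1 looks for a point c of F1 z1 close to the shell of v at z2 and
to F1 z3; its critical triple, with a single shell at z1, is settled by Helly
at z3, where only u, v and two indices at z3 occur. The point of the shell near
c is the one wanted, at the cost of the detour from z2 to z3 through z1. *)
Lemma near_refine1_near_refine1_shell z1 z2 z3 v :
  meet3 (thicken (refine1 z1) (D z2 z1))
        (thicken (refine1 z3) (D z2 z1 + D z1 z3)) (shell z2 v).
Proof.
pose X := thicken (shell z2 v) (D z2 z1).
pose Y := thicken (refine1 z3) (D z1 z3).
have cX : convex X by apply: convex_thicken; exact: convex_shell.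
have cY : convex Y by apply: convex_thicken; exact: convex_refine1.
have [u u'|u u'|u|c [[b vb cb] [y y3 cy] c1]] :=
  helly_extra2 z1 (convex_shell z1) cX cY (@shell3 z1).
- have [f [fL [fu fu' fv _]]] := FP4 u u' v v.
  exists (f z1); split; [|by exists (f u)|by exists (f u')].
  by exists (f z2); [exists (f v)|rewrite Dsym].
- exact: near_refine1_shell2.
- have cZ : convex (thicken (X `&` shell z1 u) (D z1 z3)).
    by apply: convex_thicken; apply: convexI => //; exact: convex_shell.
  have [w w'|y [[x [xX xu] yx] y3]] :=
      helly_extra1 z1 (convex_shell z3) cZ (@shell3 z3).
    have [f [fL [fu fv fw fw']]] := FP4 u v w w'.
    exists (f z3); split; [|by exists (f w)|by exists (f w')].
    exists (f z1); last by rewrite Dsym.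
    split; last by exists (f u).
    by exists (f z2); [exists (f v)|rewrite Dsym].
  by exists x; split=> //; exists y => //; rewrite distrC.
exists b; split=> //; first by exists c => //; rewrite distrC.
exists y => //; apply: le_trans (ler_distD c _ _) _.
by rewrite lerD// distrC.
Qed.

Lemma refine1_triple z1 z2 z3 : exists a w y,
  [/\ refine1 z1 a, refine1 z2 w, refine1 z3 y, `|w - a| <= D z2 z1
    & `|w - y| <= D z2 z1 + D z1 z3].
Proof.
have [|||u u'|||w [[a a1 wa] [y y3 wy] w2]] := helly_extra2 z2 (convex_shell z2)
  (X := thicken (refine1 z1) (D z2 z1))
  (Y := thicken (refine1 z3) (D z2 z1 + D z1 z3)).
- by apply: convex_thicken; exact: convex_refine1.
- by apply: convex_thicken; exact: convex_refine1.
- exact: shell3.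
- exact: near_refine1_shell2.
- move=> u u'; have [p [p3 pu pu']] := near_refine1_shell2 z2 z3 u u'.
  by exists p; split=> //; apply: thickenW p3; exact: Dtri.
- exact: near_refine1_near_refine1_shell.
by exists a, w, y.
Qed.

(** With r_i = D x z_i, the points a, w and y of [refine1_triple] satisfy
|a - w| <= r1 + r2, |w - y| <= 2 r1 + r2 + r3 and |a - y| <= 3 r1 + 2 r2 + r3.
As r1, r2 <= r3, the squares of radii 3 r_i around them meet pairwise; the
factor 3 is needed for the last pair. *)
Lemma refine2_triple x z1 z2 z3 : D x z1 <= D x z3 -> D x z2 <= D x z3 ->
  meet3 (thicken (refine1 z1) (3 * D x z1)) (thicken (refine1 z2) (3 * D x z2))
        (thicken (refine1 z3) (3 * D x z3)).
Proof.
move=> r13 r23; have [a [w [y [a1 w2 y3 wa wy]]]] := refine1_triple z1 z2 z3.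
have := Dtri z2 z1 x; have := Dtri z1 z3 x; rewrite !(Dsym _ x) => h13 h21.
have := D_ge0 x z1; have := D_ge0 x z2; have := D_ge0 x z3 => r3 r2 r1.
have ay : `|a - y| <= 3 * D x z1 + 3 * D x z3.
  apply: le_trans (ler_distD w _ _) _; move: wa; rewrite distrC; lra.
have [|||||| m [ma mw my]] := @square3 _ a w y
  (3 * D x z1) (3 * D x z2) (3 * D x z3); try lra.
  by rewrite distrC; lra.
by exists m; split; [exists a|exists w|exists y].
Qed.

Lemma refine2_meet3 x z1 z2 z3 :
  meet3 (thicken (refine1 z1) (3 * D x z1)) (thicken (refine1 z2) (3 * D x z2))
        (thicken (refine1 z3) (3 * D x z3)).
Proof.
have [h13|/ltW h31] := leP (D x z1) (D x z3);
have [h23|/ltW h32] := leP (D x z2) (D x z3).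
- exact: refine2_triple.
- have [p [? ? ?]] := refine2_triple (le_trans h13 h32) h32.
  by exists p.
- have [p [? ? ?]] := refine2_triple (le_trans h23 h31) h31.
  by exists p.
- have [h12|/ltW h21] := leP (D x z1) (D x z2).
    have [p [? ? ?]] := refine2_triple h12 h32.
    by exists p.
  have [p [? ? ?]] := refine2_triple h31 h21.
  by exists p.
Qed.

Let cS x z : convex (thicken (refine1 z) (3 * D x z)).
Proof. by apply: convex_thicken; exact: convex_refine1. Qed.

Lemma refine2_nonempty x : refine2 x !=set0.
Proof.
by have [p hp] := helly (@cS x) (refine2_meet3 x); exists p.
Qed.

(** The shell of v at z' has a radius that differs from that at z by at most
D z z'. *)
Lemma refine1_sub_shell z z' v c :
  refine1 z c -> thicken (shell z' v) (D z z') c.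
Proof.
move=> /(_ v)[a va ca]; have := Dtri z v z' => tri.
have [||||| | m [mc ma _]] := @square3 _ c a a (D z z') (D z' v) (D z' v) => //.
- by apply: le_trans ca _.
- by apply: le_trans ca _.
- by rewrite subrr normr0 addr_ge0.
by exists m; [exists a|rewrite distrC].
Qed.

(** The Helly triple of a shell at z2, the thickening of F1 z1 and the square
around p needs no selection: p1 itself is within D z1 z2 of the shell, by
[refine1_sub_shell]. *)
Lemma refine1_close_near z1 z2 p p1 p2 (e1 e2 : R) :
  refine1 z1 p1 -> refine1 z2 p2 -> `|p1 - p| <= e1 -> `|p2 - p| <= e2 ->
  exists c1 c2, [/\ refine1 z1 c1, refine1 z2 c2, `|c1 - c2| <= D z1 z2
    & `|c2 - p| <= Num.max e2 (e1 + D z1 z2)].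
Proof.
move=> h1 h2 pe1 pe2; set e := Num.max _ _.
have [||||||c2 [[c1 hc1 c12] c2p hc2]] := helly_extra2 z2 (convex_shell z2)
  (X := thicken (refine1 z1) (D z1 z2)) (Y := [set q | `|q - p| <= e]).
- by apply: convex_thicken; exact: convex_refine1.
- exact: convex_ball.
- exact: shell3.
- by rewrite Dsym; exact: near_refine1_shell2.
- move=> u u'; exists p2; split=> //=.
  by rewrite /e le_max pe2.
- move=> u; have [v vu p1v] := refine1_sub_shell z2 u h1.
  exists v; split=> //=; first by exists p1 => //; rewrite distrC.
  rewrite /e le_max; apply/orP; right.
  apply: le_trans (ler_distD p1 _ _) _; rewrite distrC in p1v.
  by rewrite addrC lerD.
by exists c1, c2; split=> //; rewrite distrC.
Qed.

(** Write r_i = D y z_i and s = D x y. The points p_i of F1 z_i given by the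
definition of F2 x satisfy |p_i - p| <= 3 r_i + 3 s, so they may be too far from
each other by 6 s; the points c_i of [refine1_close_near] are within r1 + r2 of
each other, but their distances to p exceed 3 r_i + 3 s by up to 4 (r1 + r2).
The combination with weight t = 3 s / (r1 + r2 + 3 s) on the c_i repairs the
former, and the latter then contributes at most 4 t (r1 + r2) <= 12 s. *)
Lemma refine2_pair x y z1 z2 p : refine2 x p ->
  meet3 [set q | `|q - p| <= 15 * D x y]
    (thicken (refine1 z1) (3 * D y z1)) (thicken (refine1 z2) (3 * D y z2)).
Proof.
move=> px; have [p1 h1 pp1] := px z1; have [p2 h2 pp2] := px z2.
have := Dtri x z1 y; have := Dtri x z2 y; have := Dtri z1 z2 y.
rewrite (Dsym z1 y).
have := D_ge0 x y; have := D_ge0 y z1; have := D_ge0 y z2.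
set s := D x y; set r1 := D y z1; set r2 := D y z2.
move=> r2_ge0 r1_ge0 s_ge0 h12 hx2 hx1.
rewrite distrC in pp1; rewrite distrC in pp2.
have {}pp1 : `|p1 - p| <= 3 * r1 + 3 * s by lra.
have {}pp2 : `|p2 - p| <= 3 * r2 + 3 * s by lra.
have [c1 [c2 [hc1 hc2 c12 cp]]] := refine1_close_near h1 h2 pp1 pp2.
have {}cp2 : `|c2 - p| <= 3 * s + 4 * r1 + 3 * r2.
  by apply: le_trans cp _; rewrite ge_max; apply/andP; split; lra.
have cp1 : `|c1 - p| <= 3 * s + 5 * r1 + 4 * r2.
  by apply: le_trans (ler_distD c2 _ _) _; lra.
(* When r1 = r2 = s = 0 the quotient is 0 and p1 = p2 = p. *)
pose t := 3 * s / (r1 + r2 + 3 * s).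
have [t0 t1 tE] : [/\ 0 <= t, t <= 1 & t * (r1 + r2 + 3 * s) = 3 * s].
  rewrite /t; have [e0|e0] := eqVneq (r1 + r2 + 3 * s) 0.
    by rewrite e0 invr0 !mulr0; split; lra.
  have e_gt0 : 0 < r1 + r2 + 3 * s by rewrite lt_def e0; lra.
  split; last by rewrite divfK.
    by rewrite divr_ge0//; lra.
  by rewrite ler_pdivrMr//; lra.
have t01 : 0 <= t <= 1 by rewrite t0 t1.
pose d1 := t *: c1 + (1 - t) *: p1; pose d2 := t *: c2 + (1 - t) *: p2.
have dE (a b : plane R) (e e' : R) : `|a - p| <= e -> `|b - p| <= e' ->
    `|t *: a + (1 - t) *: b - p| <= t * e + (1 - t) * e'.
  move=> ae be; have -> : t *: a + (1 - t) *: b - p =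
    t *: a + (1 - t) *: b - (t *: p + (1 - t) *: p).
    by rewrite conv_diag.
  apply: (le_trans (dist_conv _ _ _ _ t01)).
  by rewrite lerD// ler_wpM2l// subr_ge0.
have d1p := dE _ _ _ _ cp1 pp1; have d2p := dE _ _ _ _ cp2 pp2.
rewrite -/d1 in d1p; rewrite -/d2 in d2p.
have p12 : `|p1 - p2| <= 3 * r1 + 3 * r2 + 6 * s.
  by apply: le_trans (ler_distD p _ _) _; rewrite (distrC p p2); lra.
have d12 : `|d1 - d2| <= t * (r1 + r2) + (1 - t) * (3 * r1 + 3 * r2 + 6 * s).
  apply: (le_trans (dist_conv _ _ _ _ t01)).
  by rewrite lerD// ler_wpM2l// ?subr_ge0//; lra.
have tr1 : 0 <= t * r1 by rewrite mulr_ge0.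
have tr2 : 0 <= t * r2 by rewrite mulr_ge0.
have ts : 0 <= t * s by rewrite mulr_ge0.
have [||||||m [mp md1 md2]] := @square3 _ p d1 d2 (15 * s) (3 * r1) (3 * r2).
- lra.
- lra.
- lra.
- by rewrite distrC; lra.
- by rewrite distrC; lra.
- lra.
exists m; split=> //; [exists d1 => //|exists d2 => //]; exact: convex_refine1.
Qed.

Lemma refine2_lipschitz x y p :
  refine2 x p -> thicken (refine2 y) (15 * D x y) p.
Proof.
move=> px; have [||z1 z2|q [pq qy]] := helly_extra1 x (@cS y)
  (X := [set q | `|q - p| <= 15 * D x y]).
- exact: convex_ball.
- exact: refine2_meet3.
- exact: refine2_pair.
by exists q => //; rewrite distrC.
Qed.

Lemma refine2_sub x : refine2 x `<=` F x.
Proof.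
move=> p /(_ x)[c /(_ x)[a Fa]].
rewrite /= D0 mulr0 !normr_le0 !subr_eq0 => /eqP-> /eqP->.
exact: Fa.
Qed.

End Refinements.

(** * Compactness, centers and truncation *)

Section Topology.
Context {R : realType}.
Implicit Types (A B S G : set (plane R)) (p q a b : plane R) (r t : R).

Lemma compact_square a r : compact (square a r).
Proof.
have -> : square a r = `[a.1 - r, a.1 + r] `*` `[a.2 - r, a.2 + r].
  apply/seteqP; split=> y;
    rewrite /square /= norm_plane_le !ler_distl !in_itv/=.
    by move=> /andP[].
  by case=> -> ->.
by apply: compact_setX; exact: segment_compact.
Qed.

Lemma nearest_point A p : closed A -> A !=set0 ->
  exists2 a, A a & forall b, A b -> `|p - a| <= `|p - b|.
Proof.
move=> clA [a0 Aa0]; pose K := square p `|p - a0| `&` A.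
have cK : compact K by apply: compact_closedI => //; exact: compact_square.
have K0 : K !=set0 by exists a0; split=> //; rewrite /square/= distrC.
have [|c] := compact_EVT_min (f := fun b : plane R => `|p - b|) K0 cK.
  apply: continuous_subspaceT => b; apply: cvg_norm.
  by apply: cvgB; [exact: cvg_cst|exact: cvg_id].
rewrite inE => -[cp Ac] cmin; exists c => // b Ab.
have [bK|bK] := leP `|p - b| `|p - a0|.
  by apply: cmin; rewrite inE; split=> //; rewrite /square/= distrC.
by apply: le_trans (ltW bK); rewrite distrC.
Qed.

(** The point of A nearest to a limit point of the thickening witnesses it. *)
Lemma closed_thicken A r : closed A -> closed (thicken A r).
Proof.
move=> clA y yA.
have [A0|] := pselect (A !=set0); last first.
  by move=> A0; have [z [[a Aa _] _]] := yA _ (filterT); case: A0; exists a.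
have [a Aa amin] := nearest_point y clA A0; exists a => //.
apply/ler_addgt0Pr => e e0.
have [z [[b Ab zb] yz]] := yA _ (nbhsx_ballx y _ e0).
apply: (le_trans (amin _ Ab)); apply: le_trans (ler_distD z _ _) _.
rewrite addrC lerD// ltW//.
by move: yz; rewrite -ball_normE.
Qed.

Lemma closed_forall (X : topologicalType) (I : Type) (S : I -> set X) :
  (forall i, closed (S i)) -> closed [set y | forall i, S i y].
Proof.
move=> cS; have -> : [set y | forall i, S i y] = \bigcap_i S i.
  by apply/seteqP; split=> y h i => [_|]; exact: h.
by apply: closed_bigI => i _; exact: cS.
Qed.

Lemma closed_refine2 (N : finType) (D : N -> N -> R)
    (F : N -> set (plane R)) x :
  (forall z, closed (F z)) -> closed (refine2 D F x).
Proof.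
move=> clF; have c1 z : closed (refine1 D F z).
  apply: (@closed_forall _ _ (fun u => shell D F z u)) => u.
  exact: closed_thicken.
apply: (@closed_forall _ _ (fun z => thicken (refine1 D F z) (3 * D x z))) => z.
exact: closed_thicken.
Qed.

Lemma compact_closed_plane A : compact A -> closed A.
Proof. by apply: compact_closed; exact: norm_hausdorff. Qed.

Lemma compact_inf S (f : plane R -> R) : continuous f -> compact S ->
  S !=set0 -> exists2 p, S p & inf (f @` S) = f p /\
    forall q, S q -> f p <= f q.
Proof.
move=> cf cS S0.
have [|p] := compact_EVT_min (f := f) S0 cS; first exact: continuous_subspaceT.
rewrite inE => Sp pmin; exists p => //.
have pm q : S q -> f p <= f q by move=> Sq; apply: pmin; rewrite inE.
split=> //; apply/eqP; rewrite eq_le; apply/andP; split.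
  by apply: ge_inf; [exists (f p) => _ [q /pm ? <-]|exists p].
by apply: lb_le_inf; [exists (f p), p|move=> _ [q /pm ? <-]].
Qed.

Lemma compact_sup S (f : plane R -> R) : continuous f -> compact S ->
  S !=set0 -> exists2 p, S p & sup (f @` S) = f p /\
    forall q, S q -> f q <= f p.
Proof.
move=> cf cS S0.
have [|p] := compact_EVT_max (f := f) S0 cS; first exact: continuous_subspaceT.
rewrite inE => Sp pmax; exists p => //.
have pm q : S q -> f q <= f p by move=> Sq; apply: pmax; rewrite inE.
split=> //; apply/eqP; rewrite eq_le; apply/andP; split.
  by apply: ge_sup; [exists (f p), p|move=> _ [q /pm ? <-]].
by apply: ub_le_sup; [exists (f p) => _ [q /pm ? <-]|exists p].
Qed.

Let cfst : continuous (fst : plane R -> R).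
Proof. by move=> p; exact: cvg_fst. Qed.
Let csnd : continuous (snd : plane R -> R).
Proof. by move=> p; exact: cvg_snd. Qed.

Lemma center_rect_hull S :
  S !=set0 -> Defs.center (rect_hull S) = Defs.center S.
Proof.
move=> [s Ss]; rewrite /Defs.center /rect_hull.
have -> : fst @` ((fst @` S) `*` (snd @` S)) = fst @` S.
  apply/seteqP; split=> [_ [p [p1 _] <-] //|x xS].
  by exists (x, s.2) => //; split=> //; exists s.
have -> // : snd @` ((fst @` S) `*` (snd @` S)) = snd @` S.
apply/seteqP; split=> [_ [p [_ p2] <-] //|x xS].
by exists (s.1, x) => //; split=> //; exists s.
Qed.

(** Points of two horizontally adjacent quadrants balance to a point of the
vertical axis, and an upper and a lower such point balance to the origin. *)
Lemma mem0_quadrants S :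
  convex S ->
  (exists2 p, S p & (0 <= p.1) && (0 <= p.2)) ->
  (exists2 p, S p & (p.1 <= 0) && (0 <= p.2)) ->
  (exists2 p, S p & (p.1 <= 0) && (p.2 <= 0)) ->
  (exists2 p, S p & (0 <= p.1) && (p.2 <= 0)) -> S 0.
Proof.
move=> cS.
have balance (a b : R) : 0 <= a -> b <= 0 ->
    exists2 t, 0 <= t <= 1 & t * a + (1 - t) * b = 0.
  move=> a0 b0; have [ab|ab] := eqVneq (a - b) 0.
    by exists 1; [rewrite ler01 lexx|lra].
  have ab0 : 0 < a - b by rewrite lt_def ab; lra.
  exists (- b / (a - b)); last by field.
  by rewrite divr_ge0 ?ler_pdivrMr//=; lra.
move=> [p Sp /andP[p1 p2]] [q Sq /andP[q1 q2]].
move=> [p' Sp' /andP[p'1 p'2]] [q' Sq' /andP[q'1 q'2]].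
have [t t01 tE] := balance _ _ p1 q1.
have [t' t'01 t'E] := balance _ _ q'1 p'1.
have Su := cS _ _ _ Sp Sq t01; have Sv := cS _ _ _ Sq' Sp' t'01.
move: Su Sv; set u := _ + _; set v := _ + _ => Su Sv.
have u1 : u.1 = 0 by exact: tE.
have v1 : v.1 = 0 by exact: t'E.
have u2 : 0 <= u.2.
  by case/andP: t01 => ? ?; rewrite addr_ge0 ?mulr_ge0 ?subr_ge0.
have v2 : v.2 <= 0.
  case/andP: t'01 => ? ?; rewrite -oppr_ge0 opprD addr_ge0// -mulrN mulr_ge0//;
  by rewrite ?subr_ge0 ?oppr_ge0.
have [s s01 sE] := balance _ _ u2 v2.
have := cS _ _ _ Su Sv s01; congr S.
rewrite [LHS]surjective_pairing; congr pair; last exact: sE.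
clearbody u v; rewrite -[LHS]/(s * u.1 + (1 - s) * v.1).
by rewrite u1 v1 !mulr0 addr0.
Qed.

(** The midpoint of a point on the right side and a point on the top side of the
bounding rectangle lies to the upper right of the center, and so on for the
other corners. *)
Lemma center_in S : convex S -> compact S -> S !=set0 -> S (Defs.center S).
Proof.
move=> cS kS S0; rewrite /Defs.center.
have [l Sl [-> lm]] := compact_inf cfst kS S0.
have [r Sr [-> rm]] := compact_sup cfst kS S0.
have [b Sb [-> bm]] := compact_inf csnd kS S0.
have [t St [-> tm]] := compact_sup csnd kS S0.
set c := (_, _).
have mid p q : S p -> S q ->
    [set x | S (x + c)] (2^-1 *: p + (1 - 2^-1) *: q - c).
  by move=> Sp Sq; rewrite /= subrK; apply: cS => //; lra.
have cS' : convex [set x | S (x + c)].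
  move=> p q s Sp Sq s01 /=; have := cS _ _ _ Sp Sq s01.
  by rewrite -{3}(conv_diag c s) addrACA -!scalerDr.
suff : [set x | S (x + c)] 0 by rewrite /= add0r.
have lb := lm _ Sb; have lt := lm _ St; have rb := rm _ Sb; have rt := rm _ St.
have bl := bm _ Sl; have br := bm _ Sr; have tl := tm _ Sl; have tr := tm _ Sr.
apply: mem0_quadrants => //.
- exists (2^-1 *: r + (1 - 2^-1) *: t - c); first exact: mid.
  by apply/andP; split; rewrite /c /= /GRing.scale/=; lra.
- exists (2^-1 *: l + (1 - 2^-1) *: t - c); first exact: mid.
  by apply/andP; split; rewrite /c /= /GRing.scale/=; lra.
- exists (2^-1 *: l + (1 - 2^-1) *: b - c); first exact: mid.
  by apply/andP; split; rewrite /c /= /GRing.scale/=; lra.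
- exists (2^-1 *: r + (1 - 2^-1) *: b - c); first exact: mid.
  by apply/andP; split; rewrite /c /= /GRing.scale/=; lra.
Qed.

Lemma center_lipschitz S S' (e : R) : compact S -> compact S' ->
  S !=set0 -> S' !=set0 -> S `<=` thicken S' e -> S' `<=` thicken S e ->
  `|Defs.center S - Defs.center S'| <= e.
Proof.
move=> kS kS' S0 S'0 SS' S'S.
have half (f : plane R -> R) : continuous f ->
    (forall p q, `|f p - f q| <= `|p - q|) ->
    `|(inf (f @` S) + sup (f @` S)) / 2 - (inf (f @` S') + sup (f @` S')) / 2|
      <= e.
  move=> cf fL.
  have [l Sl [-> lm]] := compact_inf cf kS S0.
  have [r Sr [-> rm]] := compact_sup cf kS S0.
  have [l' Sl' [-> lm']] := compact_inf cf kS' S'0.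
  have [r' Sr' [-> rm']] := compact_sup cf kS' S'0.
  have [p Sp pl] := SS' _ Sl; have [q Sq qr] := SS' _ Sr.
  have [p' Sp' pl'] := S'S _ Sl'; have [q' Sq' qr'] := S'S _ Sr'.
  have := lm' _ Sp; have := rm' _ Sq; have := lm _ Sp'; have := rm _ Sq'.
  have := le_trans (fL _ _) pl; have := le_trans (fL _ _) qr.
  have := le_trans (fL _ _) pl'; have := le_trans (fL _ _) qr'.
  rewrite !ler_norml => /andP[? ?] /andP[? ?] /andP[? ?] /andP[? ?] ? ? ? ?.
  by apply/andP; split; lra.
have coord_le p q : (`|p.1 - q.1| <= `|p - q|) && (`|p.2 - q.2| <= `|p - q|).
  exact: etrans (esym (norm_plane_le (p - q) _)) (lexx _).
rewrite norm_plane_le; apply/andP.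
by split; apply: half => // p q; have /andP[] := coord_le p q.
Qed.

Lemma dist_attained A p : closed A -> A !=set0 ->
  exists2 a, A a & dist p A = `|p - a| /\ forall b, A b -> `|p - a| <= `|p - b|.
Proof.
move=> clA A0; have [a Aa amin] := nearest_point p clA A0; exists a => //.
split=> //; apply/eqP; rewrite eq_le; apply/andP; split.
  by apply: ge_inf; [exists `|p - a| => _ [b /amin ? <-]|exists a].
by apply: lb_le_inf; [exists `|p - a|, a|move=> _ [b /amin ? <-]].
Qed.

Definition truncate G : set (plane R) := G `&` square 0 (2 * dist 0 G).

Lemma truncate_nonempty G : closed G -> G !=set0 -> truncate G !=set0.
Proof.
move=> clG G0; have [g Gg [gE _]] := dist_attained 0 clG G0.
exists g; split=> //; rewrite /square/= gE subr0 sub0r normrN.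
have := normr_ge0 g; lra.
Qed.

Lemma compact_truncate G : closed G -> compact (truncate G).
Proof.
by move=> clG; rewrite /truncate setIC; apply: compact_closedI => //;
  exact: compact_square.
Qed.

(** A point q of G' near a point of the truncation of G has norm at most
2 |h| + 3 d, where h is the point of G' nearest to the origin. When |q| > 2 |h|,
the combination q' of q and h with weight t = |h| / (|q| - |h|) on q has norm at
most t |q| + (1 - t) |h| = 2 |h|, and |q - q'| = (1 - t) |q - h| is at most
(|q| - 2 |h|) (|q| + |h|) / (|q| - |h|) <= 3 (|q| - 2 |h|) <= 9 d. *)
Lemma truncate_hausdorff G G' (d : R) : convex G' -> closed G -> closed G' ->
  G !=set0 -> G' !=set0 -> G `<=` thicken G' d -> G' `<=` thicken G d ->
  truncate G `<=` thicken (truncate G') (10 * d).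
Proof.
move=> cG' clG clG' G0 G'0 GG' G'G p [Gp]; rewrite /square/= subr0 => pr.
have [g Gg [gE gm]] := dist_attained 0 clG G0.
have [h Gh [hE hm]] := dist_attained 0 clG' G'0.
move: pr; rewrite gE sub0r normrN => pr; rewrite /truncate hE sub0r normrN.
have [q Gq pq] := GG' _ Gp; have [g' Gg' hg'] := G'G _ Gh.
have gh : `|g| <= `|h| + d.
  have := gm _ Gg'; rewrite !sub0r !normrN => gg'.
  have := ler_normB h (h - g'); rewrite subKr => ?; lra.
have qn : `|q| <= 2 * `|h| + 3 * d.
  have := ler_normB p (p - q); rewrite subKr => ?; lra.
have d0 : 0 <= d by apply: le_trans pq.
have [qh|qh] := leP `|q| (2 * `|h|).
  by exists q; [split; rewrite // /square/= subr0|lra].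
have h0 := normr_ge0 h; have qh0 : 0 < `|q| - `|h| by lra.
pose t := `|h| / (`|q| - `|h|).
have [t0 t1 tE] : [/\ 0 <= t, t <= 1 & t * (`|q| - `|h|) = `|h|].
  rewrite /t; split; last by rewrite divfK// gt_eqF.
    by rewrite divr_ge0// ltW.
  by rewrite ler_pdivrMr//; lra.
pose q' := t *: q + (1 - t) *: h.
have Gq' : G' q' by apply: cG' => //; rewrite t0.
have q'n : `|q'| <= 2 * `|h|.
  have t01 : 0 <= t <= 1 by rewrite t0.
  have := dist_conv q h 0 0 t01; rewrite !scaler0 addr0 !subr0.
  by move=> /le_trans; apply; lra.
have qq' : `|q - q'| <= 9 * d.
  have -> : q - q' = (1 - t) *: (q - h).
    by rewrite /q' -{1}(conv_diag q t) opprD addrACA subrr add0r -scalerBr.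
  rewrite normrZ; have -> : `|1 - t| = 1 - t by rewrite ger0_norm// subr_ge0.
  have : (1 - t) * `|q - h| <= (1 - t) * (`|q| + `|h|).
    by rewrite ler_wpM2l ?subr_ge0// ler_normB.
  have : 0 <= (1 - t) * (`|q| - 2 * `|h|) by rewrite mulr_ge0 ?subr_ge0// ltW.
  lra.
exists q'; first by split; rewrite // /square/= subr0.
by apply: le_trans (ler_distD q _ _) _; lra.
Qed.

End Topology.

(** * Attainment of the optimal constant *)

Section FourierMotzkin.
Context {R : realType}.

(** The inequalities with a k < 0 bound t from below, those with a k > 0 from
above, and the greatest lower bound lies below the least upper bound. *)
Lemma line_feasible (K : finType) (a b : K -> R) :
  (forall k, a k = 0 -> 0 <= b k) ->
  (forall p q, 0 < a p -> a q < 0 -> 0 <= - a q * b p + a p * b q) ->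
  exists t, forall k, a k * t <= b k.
Proof.
move=> h0 hpq.
have [[q0 q0N]|noneg] := pselect (exists q, a q < 0).
  have [q qN qmax] :=
    @arg_maxP _ _ _ q0 (fun q => a q < 0) (fun q => b q / a q) q0N.
  exists (b q / a q) => k; have [k0|k0|k0] := ltgtP (a k) 0.
  - have : b k / a k <= b q / a q by exact: qmax.
    by rewrite ler_ndivrMr// mulrC.
  - rewrite mulrA ler_ndivrMr//; have := hpq k q k0 qN; lra.
  - by rewrite k0 mul0r h0.
have [[p0 p0P]|nopos] := pselect (exists p, 0 < a p).
  have [p pP pmin] :=
    @arg_minP _ _ _ p0 (fun p => 0 < a p) (fun p => b p / a p) p0P.
  exists (b p / a p) => k; have [k0|k0|k0] := ltgtP (a k) 0.
  - by case: noneg; exists k.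
  - have : b p / a p <= b k / a k by exact: pmin.
    by rewrite ler_pdivlMr// mulrC.
  - by rewrite k0 mul0r h0.
exists 0 => k; rewrite mulr0; apply: h0.
have [k0|k0|//] := ltgtP (a k) 0; first by case: noneg; exists k.
by case: nopos; exists k.
Qed.

(** Induction on the variables that occur. The elimination of x replaces the
system by the combinations with coefficients c1 and c2 of two inequalities in
which x cancels; it commutes with the perturbation e * d, so the eliminated
system again satisfies the hypothesis. The inequalities free of x are obtained
as c1 = 1 and c2 = 0. *)
Lemma linear_system_limit (J : finType) (s : seq J) (K : finType)
    (a : K -> J -> R) (b d : K -> R) :
  (forall k j, j \notin s -> a k j = 0) ->
  (forall e, 0 < e ->
    exists y : J -> R, forall k, \sum_j a k j * y j <= b k + e * d k) ->
  exists y : J -> R, forall k, \sum_j a k j * y j <= b k.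
Proof.
elim: s K a b d => [|x s IH] K a b d supp feas.
  exists (fun=> 0) => k; rewrite big1; last by move=> j _; rewrite mulr0.
  have sum0 (y : J -> R) : \sum_j a k j * y j = 0.
    by apply: big1 => j _; rewrite supp// mul0r.
  have bd e : 0 < e -> 0 <= b k + e * d k.
    by move=> /feas[y /(_ k)]; rewrite sum0.
  have [//|bN] := leP 0 (b k).
  have [dk|dk] := leP (d k) 0; first by have := bd 1 ltr01; lra.
  have e0 : 0 < - b k / (2 * d k) by rewrite divr_gt0//; lra.
  have := bd _ e0; have -> : - b k / (2 * d k) * d k = - b k / 2.
    by field; rewrite gt_eqF.
  lra.
pose c1 p q : R := if (0 < a p x) && (a q x < 0) then - a q x
                   else (a p x == 0)%:R.
pose c2 p q : R := if (0 < a p x) && (a q x < 0) then a p x else 0.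
have c1_ge0 p q : 0 <= c1 p q.
  by rewrite /c1; case: andP => [[_ /ltW]|_]; rewrite ?oppr_ge0.
have c2_ge0 p q : 0 <= c2 p q.
  by rewrite /c2; case: andP => [[/ltW]|_].
have c12 p q : c1 p q * a p x + c2 p q * a q x = 0.
  rewrite /c1 /c2; case: ifP => _; first by ring.
  by have [->|_] := eqVneq (a p x) 0; rewrite ?mulr0 ?mul0r ?addr0.
have lin (y : J -> R) p q (P : pred J) :
    \sum_(j | P j) (c1 p q * a p j + c2 p q * a q j) * y j =
    c1 p q * (\sum_(j | P j) a p j * y j)
    + c2 p q * (\sum_(j | P j) a q j * y j).
  rewrite !mulr_sumr -big_split; apply: eq_bigr => j _ /=.
  by rewrite mulrDl !mulrA.
have [k j js|e e0|y hy] := IH (K * K)%type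
    (fun k j => c1 k.1 k.2 * a k.1 j + c2 k.1 k.2 * a k.2 j)
    (fun k => c1 k.1 k.2 * b k.1 + c2 k.1 k.2 * b k.2)
    (fun k => c1 k.1 k.2 * d k.1 + c2 k.1 k.2 * d k.2).
- have [->|jx] := eqVneq j x; first exact: c12.
  by rewrite !supp ?mulr0 ?addr0// inE negb_or jx.
- have [y hy] := feas e e0; exists y => -[p q] /=.
  rewrite (lin y p q predT).
  have : c1 p q * (\sum_j a p j * y j) <= c1 p q * (b p + e * d p).
    by rewrite ler_wpM2l.
  have : c2 p q * (\sum_j a q j * y j) <= c2 p q * (b q + e * d q).
    by rewrite ler_wpM2l.
  lra.
pose rest k := b k - \sum_(j | j != x) a k j * y j.
have hrest p q : 0 <= c1 p q * rest p + c2 p q * rest q.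
  have := hy (p, q); rewrite /= (bigD1 x)//= c12 mul0r add0r lin /rest; lra.
have [k ak|p q ap aq|t ht] := line_feasible (a := fun k => a k x) (b := rest).
- by have := hrest k k; rewrite /c1 /c2 ak ltxx eqxx/= mul1r mul0r addr0.
- by have := hrest p q; rewrite /c1 /c2 ap aq.
exists (fun j => if j == x then t else y j) => k.
rewrite (bigD1 x)//= eqxx.
under eq_bigr => j /negbTE jx do rewrite jx.
by have := ht k; rewrite /rest; lra.
Qed.

End FourierMotzkin.

Section Attainment.
Context {R : realType} {I : finType}.
Variables (d : I -> I -> R) (l : R) (G : I -> set (plane R)).
Hypothesis d_ge0 : forall i j, 0 <= d i j.
Hypothesis dsym : forall i j, d i j = d j i.
Hypothesis almost : forall e, 0 < e -> exists f : I -> plane R,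
  (forall i, G i (f i)) /\ (forall i j, `|f i - f j| <= (l + e) * d i j).

Lemma half_planes_attained : (forall i, closed_half_planes (G i)) ->
  exists f : I -> plane R,
    (forall i, G i (f i)) /\ (forall i j, `|f i - f j| <= l * d i j).
Proof.
move=> /choice[n /choice[c hG]].
pose J := (I * bool)%type; pose K := (I + I * I * bool)%type.
pose dl (j0 j : J) : R := (j == j0)%:R.
pose a (k : K) (j : J) : R := match k with
  | inl i => (n i).1 * dl (i, true) j + (n i).2 * dl (i, false) j
  | inr (i, i', t) => dl (i, t) j - dl (i', t) j end.
pose b (k : K) : R := match k with
  | inl i => c i | inr (i, i', t) => l * d i i' end.
pose db (k : K) : R := match k with
  | inl i => 0 | inr (i, i', t) => d i i' end.
have dlE (y : J -> R) j0 : \sum_j dl j0 j * y j = y j0.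
  rewrite (bigD1 j0)//= /dl eqxx mul1r big1 ?addr0// => j /negbTE->.
  by rewrite mul0r.
have aE (y : J -> R) k : \sum_j a k j * y j = match k with
  | inl i => (n i).1 * y (i, true) + (n i).2 * y (i, false)
  | inr (i, i', t) => y (i, t) - y (i', t) end.
  case: k => [i|[[i i'] t]] /=.
    under eq_bigr do rewrite mulrDl -!mulrA.
    by rewrite big_split/= -!mulr_sumr !dlE.
  under eq_bigr do rewrite mulrBl.
  by rewrite sumrB !dlE.
have [k j|e e0|y hy] := @linear_system_limit _ J (enum {: J}) K a b db.
- by rewrite mem_enum.
- have [f [fG fL]] := almost e0.
  exists (fun j => if j.2 then (f j.1).1 else (f j.1).2) => k; rewrite aE.
  case: k => [i|[[i i'] t]] /=.
    by rewrite mulr0 addr0; have := fG i; rewrite (hG i).2.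
  have := fL i i'; rewrite mulrDl norm_plane_le => /andP[f1 f2].
  by case: t; [exact: le_trans (ler_norm _) f1|exact: le_trans (ler_norm _) f2].
exists (fun i => (y (i, true), y (i, false))); split=> [i|i i'].
  by have := hy (inl i); rewrite aE (hG i).2.
have h t := hy (inr (i, i', t)); have h' t := hy (inr (i', i, t)).
have {}h t : y (i, t) - y (i', t) <= l * d i i' by have := h t; rewrite aE.
have {}h' t : y (i', t) - y (i, t) <= l * d i i'.
  by have := h' t; rewrite aE dsym.
have := h true; have := h false; have := h' true; have := h' false.
rewrite norm_plane_le !ler_norml => ? ? ? ?.
by do 2 (apply/andP; split) => /=; lra.
Qed.

(** The sum of the amounts by which f violates the Lipschitz conditions is a
continuous function on a compact product; it attains its infimum 0. *)
Lemma compacts_attained : (forall i, compact (G i)) ->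
  exists f : I -> plane R,
    (forall i, G i (f i)) /\ (forall i j, `|f i - f j| <= l * d i j).
Proof.
move=> cG.
pose PT := prod_topology (fun _ : I => plane R).
pose K := [set f : PT | forall i, G i (f i)].
have cK : compact K by exact: tychonoff.
have K0 : K !=set0 by have [f [fG _]] := almost ltr01; exists f.
pose ex (f : I -> plane R) i j : R := `|f i - f j| - l * d i j.
(* x + |x| is twice the positive part of x. *)
pose phi (f : PT) : R :=
  \sum_(ij : I * I) (ex f ij.1 ij.2 + `|ex f ij.1 ij.2|).
have cdist i j : continuous (fun f : PT => `|f i - f j|).
  move=> f; apply: (@cvg_norm _ (plane R) _ (nbhs f)).
  apply: (@cvgB R (plane R) _ (nbhs f) _ (fun g : PT => g i) (fun g => g j)).
    exact: (@proj_continuous I (fun _ => plane R) i f).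
  exact: (@proj_continuous I (fun _ => plane R) j f).
have cex i j : continuous (fun f : PT => ex f i j).
  move=> f; apply: (@cvgB R R _ (nbhs f) _ (fun g : PT => `|g i - g j|)
    (fun=> l * d i j)); [exact: cdist|exact: cvg_cst].
have cphi : continuous phi.
  apply: continuous_big; first exact: add_continuous.
  move=> [i j] _ f; apply: (@cvgD R R _ (nbhs f) _ (fun g : PT => ex g i j)
    (fun g => `|ex g i j|)); first exact: cex.
  by apply: (@cvg_norm R R _ (nbhs f)); exact: cex.
have [|f] := compact_EVT_min (f := phi) K0 cK.
  exact: continuous_subspaceT.
rewrite inE => Kf fmin; exists f; split=> // i j.
have phi0 (g : I -> plane R) i' j' : 0 <= ex g i' j' + `|ex g i' j'|.
  by have := ler_norm (- ex g i' j'); rewrite normrN; lra.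
have : phi f <= 0.
  apply/ler_addgt0Pr => e e0; rewrite add0r.
  pose S := \sum_(ij : I * I) d ij.1 ij.2.
  have S0 : 0 <= S by apply: sumr_ge0.
  have e'0 : 0 < e / (2 * (S + 1)) by rewrite divr_gt0//; lra.
  have [g [gG gL]] := almost e'0.
  have /fmin : g \in K by rewrite inE.
  move=> /le_trans; apply.
  have : phi g <= \sum_(ij : I * I) (2 * (e / (2 * (S + 1))) * d ij.1 ij.2).
    apply: ler_sum => -[i' j'] _ /=.
    have := gL i' j'; rewrite mulrDl => gij.
    have ed : 0 <= e / (2 * (S + 1)) * d i' j' by rewrite mulr_ge0// ltW.
    have : ex g i' j' <= e / (2 * (S + 1)) * d i' j' by rewrite /ex; lra.
    have [x0|x0] := leP 0 (ex g i' j').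
      by rewrite ger0_norm//; lra.
    by rewrite ltr0_norm//; lra.
  rewrite -mulr_sumr -/S => /le_trans; apply.
  have -> : 2 * (e / (2 * (S + 1))) * S = e * (S / (S + 1)) by field; lra.
  by rewrite ler_piMr ?(ltW e0)// ler_pdivrMr; lra.
rewrite /phi (bigD1 (i, j))//= => h.
have : 0 <= \sum_(ij | ij != (i, j)) (ex f ij.1 ij.2 + `|ex f ij.1 ij.2|).
  by apply: sumr_ge0 => ij _; exact: phi0.
have := normr_ge0 (ex f i j); move: h; rewrite /ex; lra.
Qed.

End Attainment.

(** * Lipschitz extension *)

Section McShane.
Context {R : realType} {N I : finType}.
Variables (D : N -> N -> R) (u : I -> N).
Hypothesis D0 : forall x, D x x = 0.
Hypothesis Dsym : forall x y, D x y = D y x.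
Hypothesis Dtri : forall x y z, D x y <= D x z + D z y.

(** The least of the functions v i + D (u i) x; the index k x attains it. *)
Lemma mcshane_scalar (i0 : I) (v : I -> R) :
  (forall i j, `|v i - v j| <= D (u i) (u j)) ->
  exists g : N -> R,
    (forall x y, `|g x - g y| <= D x y) /\ forall i, g (u i) = v i.
Proof.
move=> vL.
have /choice[k hk] (x : N) :
    exists k, forall i, v k + D (u k) x <= v i + D (u i) x.
  have [k _ kmin] := @arg_minP _ _ _ i0 predT (fun i => v i + D (u i) x) isT.
  by exists k => i; exact: kmin.
exists (fun x => v (k x) + D (u (k x)) x); split=> [x y|i].
  have := hk x (k y); have := hk y (k x).
  have := Dtri (u (k x)) y x; have := Dtri (u (k y)) x y.
  by rewrite (Dsym y x) ler_norml => ? ? ? ?; apply/andP; split; lra.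
apply/eqP; rewrite eq_le; apply/andP; split.
  by have := hk (u i) i; rewrite D0 addr0.
by have := vL i (k (u i)); rewrite (Dsym (u i)) ler_norml => /andP[_]; lra.
Qed.

Lemma mcshane (i0 : I) (v : I -> plane R) :
  (forall i j, `|v i - v j| <= D (u i) (u j)) ->
  exists g : N -> plane R,
    (forall x y, `|g x - g y| <= D x y) /\ forall i, g (u i) = v i.
Proof.
move=> vL.
have [i j|g [gL gE]] := mcshane_scalar i0 (v := fun i => (v i).1).
  by have := vL i j; rewrite norm_plane_le => /andP[].
have [i j|h [hL hE]] := mcshane_scalar i0 (v := fun i => (v i).2).
  by have := vL i j; rewrite norm_plane_le => /andP[].
exists (fun x => (g x, h x)); split=> [x y|i].
  by rewrite norm_plane_le; apply/andP; split; [exact: gL|exact: hL].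
by rewrite gE hE -surjective_pairing.
Qed.

End McShane.

(** * The two families of sets *)

Section Families.
Context {R : realType}.
Implicit Types (S : set (plane R)) (p q : plane R).

Lemma convex_convex_set S : convex_set (M := plane R) S -> convex S.
Proof.
move=> cS p q t Sp Sq /andP[t0 t1].
have := cS p q (Itv01 t0 t1); rewrite !inE; exact.
Qed.

Lemma half_plane_convex S : closed_half_planes S -> convex S.
Proof.
move=> [n [c [_ ->]]] p q t /= hp hq /andP[t0 t1].
rewrite -[X in _ * X + _]/(t * p.1 + (1 - t) * q.1).
rewrite -[X in _ + _ * X]/(t * p.2 + (1 - t) * q.2).
have : t * (n.1 * p.1 + n.2 * p.2) <= t * c by rewrite ler_wpM2l.
have : (1 - t) * (n.1 * q.1 + n.2 * q.2) <= (1 - t) * c.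
  by rewrite ler_wpM2l ?subr_ge0.
lra.
Qed.

Lemma half_plane_closed S : closed_half_planes S -> closed S.
Proof.
move=> [n [c [_ ->]]].
apply: (@closed_comp _ _ (fun p : plane R => n.1 * p.1 + n.2 * p.2)
  [set y | y <= c]); last exact: closed_le.
move=> p _; apply: cvgD; apply: cvgM; try exact: cvg_cst.
  exact: cvg_fst.
exact: cvg_snd.
Qed.

Lemma half_plane_nonempty S : closed_half_planes S -> S !=set0.
Proof.
move=> [n [c [n0 ->]]]; pose m := n.1 ^+ 2 + n.2 ^+ 2.
have m0 : m != 0.
  apply: contraNneq n0 => /eqP; rewrite paddr_eq0 ?sqr_ge0// !sqrf_eq0.
  by move=> /andP[/eqP n1 /eqP n2]; rewrite [n]surjective_pairing n1 n2.
exists (c / m * n.1, c / m * n.2) => /=.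
suff -> : n.1 * (c / m * n.1) + n.2 * (c / m * n.2) = c by [].
by transitivity (c / m * m); [rewrite [in RHS]/m; ring|rewrite divfK].
Qed.

End Families.

(** * Reduction to finite distances *)

Section Pseudometric.
Local Open Scope ereal_scope.
Context {R : realType} {M : finType}.
Variables (rho : M -> M -> \bar R).
Hypothesis hrho : is_pseudometric rho.

Lemma scale_dist_fin (l : R) t : t \is a fin_num ->
  scale_dist l t = (l * fine t)%:E.
Proof. by case: t. Qed.

Lemma scale_dist_ge0 (l : R) x y : (0 <= l)%R -> 0 <= scale_dist l (rho x y).
Proof.
move=> l0; rewrite /scale_dist; case: ifP => _ //.
by rewrite mule_ge0 ?lee_fin// (pseudometric_ge0 hrho).
Qed.

Lemma minkowski_sum_dilateP (A : set (plane R)) (t : \bar R) y : 0 <= t ->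
  minkowski_sum A (dilate_Q0 t) y <-> exists2 a, A a & `|y - a|%:E <= t.
Proof.
case: t => [r|_|//] /=; last first.
  split=> [[a Aa _]|[a Aa _]]; first by exists a => //; rewrite leey.
  by exists a => //; exists (y - a)%R => //; rewrite addrC subrK.
rewrite lee_fin => r0; split=> [[a Aa [_ [q [q1 q2] <-] <-]]|[a Aa]].
  exists a => //; rewrite lee_fin addrC addKr.
  move: q1 q2; rewrite /= !in_itv/= => q1 q2.
  rewrite norm_plane_le -[(r *: q).1%R]/(r * q.1)%R -[(r *: q).2%R]/(r * q.2)%R.
  rewrite !normrM (ger0_norm r0).
  by apply/andP; split; rewrite ler_piMr// ler_norml.
rewrite lee_fin => ya; exists a => //.
exists (y - a)%R; last by rewrite addrC subrK.
have [r00|rn0] := eqVneq r 0%R.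
  move: ya; rewrite r00 normr_le0 => /eqP->.
  exists 0%R; last by rewrite scaler0.
  by split; rewrite /= in_itv/= oppr_le0 ler01.
exists (r^-1 *: (y - a))%R; last by rewrite scalerA divff// scale1r.
have rp : (0 < r)%R by rewrite lt_def rn0.
have : (`|r^-1 *: (y - a)| <= 1)%R.
  by rewrite normrZ ger0_norm ?invr_ge0// mulrC ler_pdivrMr// mul1r.
by rewrite norm_plane_le !ler_norml => /andP[h1 h2]; split; rewrite /= in_itv.
Qed.

Lemma refinementP (G : M -> set (plane R)) (l : R) x y : (0 <= l)%R ->
  refinement rho G l x y <->
  forall z, exists2 a, G z a & `|y - a|%:E <= scale_dist l (rho x z).
Proof.
move=> l0; have P z := minkowski_sum_dilateP (G z) y (scale_dist_ge0 x z l0).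
by split=> h z; [apply/P; exact: h|move=> _; apply/P].
Qed.

(** Finiteness of rho is an equivalence relation, so rho is real-valued on the
class of x0, and [refine1] and [refine2] apply to this class as a type. *)
Definition finite_class (x0 : M) := {z : M | rho x0 z < +oo}.

Definition class_dist (l : R) (x0 : M) (z w : finite_class x0) : R :=
  (l * fine (rho (val z) (val w)))%R.

Lemma class_fin x0 (z w : finite_class x0) : rho (val z) (val w) \is a fin_num.
Proof.
rewrite ge0_fin_numE ?(pseudometric_ge0 hrho)//.
apply: le_lt_trans (pseudometric_triangle hrho _ _ x0) _.
rewrite (pseudometric_sym hrho _ x0) lte_add_pinfty//.
  exact: (svalP z).
exact: (svalP w).
Qed.

Lemma class_outside x0 (x : finite_class x0) z : ~ rho x0 z < +oo ->
  rho (val x) z = +oo.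
Proof.
move=> hz; apply/eqP; apply/negPn/negP; rewrite -ltey => xz; apply: hz.
apply: le_lt_trans (pseudometric_triangle hrho _ _ (val x)) _.
by rewrite lte_add_pinfty//; exact: (svalP x).
Qed.

Lemma class_dist0 l x0 (z : finite_class x0) : class_dist l z z = 0%R.
Proof. by rewrite /class_dist (pseudometric_refl hrho) mulr0. Qed.

Lemma class_dist_sym l x0 (z w : finite_class x0) :
  class_dist l z w = class_dist l w z.
Proof. by rewrite /class_dist (pseudometric_sym hrho). Qed.

Lemma class_dist_triangle l x0 (x y z : finite_class x0) : (0 <= l)%R ->
  (class_dist l x y <= class_dist l x z + class_dist l z y)%R.
Proof.
move=> l0; rewrite /class_dist -mulrDr ler_wpM2l// -fineD ?class_fin//.
by rewrite fine_le ?fin_numD ?class_fin//; exact: (pseudometric_triangle hrho).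
Qed.

Lemma lip_norm_lt (S : {set M}) (f : M -> plane R) (l : R) :
  lip_norm rho S f < l%:E ->
  {in S &, forall x y, `|f x - f y|%:E <= scale_dist l (rho x y)}.
Proof.
move=> /ereal_inf_lt[_ [k [k0 fk] <-]]; rewrite lte_fin => kl x y xS yS.
apply: (le_trans (fk x y xS yS)); rewrite /scale_dist; case: ifP => // _.
by rewrite lee_wpmul2r ?(pseudometric_ge0 hrho)// lee_fin ltW.
Qed.

Lemma lip_norm_le (S : {set M}) (f : M -> plane R) (l : R) : (0 <= l)%R ->
  {in S &, forall x y, `|f x - f y|%:E <= scale_dist l (rho x y)} ->
  lip_norm rho S f <= l%:E.
Proof. by move=> l0 fl; apply: ereal_inf_lbound; exists l. Qed.

Section Selection.
Variables (F : M -> set (plane R)) (lam : R).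
Variable T : set (set (plane R)).
Hypothesis hT : T = convex_compacts \/ T = closed_half_planes.
Hypothesis hF : forall x, T (F x).
Hypothesis hlam : LambdaFP rho F <= lam%:E.

Lemma F_convex x : convex (F x).
Proof.
have := hF x; case: hT => ->; last exact: half_plane_convex.
by case=> _ + _; exact: convex_convex_set.
Qed.

Lemma F_closed x : closed (F x).
Proof.
have := hF x; case: hT => ->; last exact: half_plane_closed.
by case=> _ _; exact: compact_closed_plane.
Qed.

Lemma F_nonempty x : F x !=set0.
Proof.
have := hF x; case: hT => ->; last exact: half_plane_nonempty.
by case.
Qed.

Lemma lam_ge0 : (0 <= lam)%R.
Proof.
rewrite -lee_fin; apply: le_trans hlam.
by apply: le_ereal_inf_tmp => _ [l [l0 _] <-]; rewrite lee_fin.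
Qed.

Lemma approximate_selection (S : {set M}) (e : R) :
  (0 < e)%R -> (#|S| <= 4)%N ->
  exists f : M -> plane R, {in S, forall x, F x (f x)} /\
    {in S &, forall x y, `|f x - f y|%:E <= scale_dist (lam + e) (rho x y)}.
Proof.
move=> e0 S4; have : LambdaFP rho F < (lam + e)%:E.
  by apply: le_lt_trans hlam _; rewrite lte_fin ltrDl.
move=> /ereal_inf_lt[_ [l [l0 hl] <-]] ll.
have [f [[fF _] fl]] := hl S S4.
by exists f; split=> //; apply: lip_norm_lt; exact: le_lt_trans ll.
Qed.

(** The approximate selections on four points given by the definition of the
infimum LambdaFP, made exact, then extended to the whole class. *)
Lemma class_four_points x0 (a b c d : finite_class x0) :
  exists f : finite_class x0 -> plane R,
    (forall x y, `|f x - f y| <= class_dist lam x y)%R /\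
    [/\ F (val a) (f a), F (val b) (f b), F (val c) (f c) & F (val d) (f d)].
Proof.
pose u (i : 'I_4) : finite_class x0 := nth a [:: a; b; c; d] i.
pose dd (i j : 'I_4) := fine (rho (val (u i)) (val (u j))).
have almost e : (0 < e)%R -> exists f : 'I_4 -> plane R,
  (forall i, F (val (u i)) (f i)) /\
  (forall i j, `|f i - f j| <= (lam + e) * dd i j)%R.
  move=> e0; pose S := [set val (u i) | i : 'I_4]%SET.
  have [||f [fF fL]] := @approximate_selection S e => //.
    have := leq_imset_card (fun i : 'I_4 => val (u i)) 'I_4.
    by rewrite card_ord.
  exists (fun i => f (val (u i))); split=> [i|i j].
    by apply: fF; exact: imset_f.
  rewrite -lee_fin -scale_dist_fin ?class_fin//.
  by apply: fL; exact: imset_f.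
have dd_ge0 i j : (0 <= dd i j)%R by rewrite fine_ge0// (pseudometric_ge0 hrho).
have ddsym i j : dd i j = dd j i by rewrite /dd (pseudometric_sym hrho).
have [v [vF vL]] : exists f : 'I_4 -> plane R,
  (forall i, F (val (u i)) (f i)) /\
  (forall i j, `|f i - f j| <= lam * dd i j)%R.
  pose Fu i := F (val (u i)); have hFu := fun i => hF (val (u i)).
  case: hT => TE; rewrite TE in hFu.
    have cFu i : compact (Fu i) by case: (hFu i).
    exact: (@compacts_attained _ _ dd lam Fu dd_ge0 almost cFu).
  exact: (@half_planes_attained _ _ dd lam Fu ddsym almost).
have [g [gL gv]] := @mcshane R _ _ (@class_dist lam x0) u (@class_dist0 lam x0)
  (@class_dist_sym lam x0)
  (fun x y z => class_dist_triangle x y z lam_ge0) 0%R v vL.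
exists g; split=> //; split.
- by have := vF 0%R; rewrite -gv.
- by have := vF 1%R; rewrite -gv.
- by have := vF (inord 2); rewrite -gv /u inordK.
- by have := vF (inord 3); rewrite -gv /u inordK.
Qed.

Let cF x0 (x : finite_class x0) : convex (F (val x)).
Proof. exact: F_convex. Qed.

Let tri x0 (x y z : finite_class x0) := class_dist_triangle x y z lam_ge0.

Let cd x0 := @class_dist lam x0.
Let cF1 x0 := refine1 (@cd x0) (fun z => F (val z)).
Let cF2 x0 := refine2 (@cd x0) (fun z => F (val z)).

(** A point at infinite distance constrains F1 only through the nonemptiness of
its value; likewise in [F2_class]. *)
Lemma F1_class x0 (x : finite_class x0) : F1 rho F lam (val x) = cF1 x.
Proof.
apply/seteqP; split=> y.
  move=> /(refinementP _ _ _ lam_ge0) h z.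
  have [a Fa] := h (val z).
  by rewrite scale_dist_fin ?class_fin// lee_fin; exists a.
move=> h; apply/(refinementP _ _ _ lam_ge0) => z.
have [zx|zx] := pselect (rho x0 z < +oo).
  have [a Fa ya] := h (exist _ z zx); exists a => //.
  by rewrite (scale_dist_fin _ (class_fin x (exist _ z zx))) lee_fin.
have [a Fa] := F_nonempty z; exists a => //.
by rewrite (class_outside x zx) /scale_dist eqxx leey.
Qed.

Definition class_self x : finite_class x.
Proof. by exists x; rewrite (pseudometric_refl hrho). Defined.

Lemma F1_nonempty x : F1 rho F lam x !=set0.
Proof.
rewrite (F1_class (class_self x)).
have [c hc _] := refine1_close (@class_dist_sym lam x)
  (@cF x) (@class_four_points x) (class_self x) (class_self x).
by exists c.
Qed.

Lemma F2_class x0 (x : finite_class x0) : F2 rho F lam (val x) = cF2 x.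
Proof.
have lam3 : (0 <= 3 * lam)%R by rewrite mulr_ge0// lam_ge0.
apply/seteqP; split=> y.
  move=> /(refinementP _ _ _ lam3) h z.
  have [a] := h (val z); rewrite F1_class => Fa.
  by rewrite scale_dist_fin ?class_fin// lee_fin -mulrA; exists a.
move=> h; apply/(refinementP _ _ _ lam3) => z.
have [zx|zx] := pselect (rho x0 z < +oo).
  have [a Fa ya] := h (exist _ z zx); exists a.
    by rewrite (F1_class (exist _ z zx)).
  by rewrite (scale_dist_fin _ (class_fin x (exist _ z zx))) lee_fin -mulrA.
have [a Fa] := F1_nonempty z; exists a => //.
by rewrite (class_outside x zx) /scale_dist eqxx leey.
Qed.

Lemma F2_nonempty x : F2 rho F lam x !=set0.
Proof.
rewrite (F2_class (class_self x)).
exact: (refine2_nonempty (@class_dist0 lam x) (@class_dist_sym lam x)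
  (@tri x) (@cF x) (@class_four_points x)).
Qed.

Lemma F2_convex x : convex (F2 rho F lam x).
Proof.
by rewrite (F2_class (class_self x)); apply: convex_refine2; exact: cF.
Qed.

Lemma F2_closed x : closed (F2 rho F lam x).
Proof.
rewrite (F2_class (class_self x)).
by apply: closed_refine2 => z; exact: F_closed.
Qed.

Lemma F2_sub x : F2 rho F lam x `<=` F x.
Proof.
rewrite (F2_class (class_self x)).
exact: (refine2_sub (F := fun z : finite_class x => F (val z))
  (@class_dist0 lam x) (x := class_self x)).
Qed.

Lemma F2_hausdorff x y : rho x y < +oo ->
  F2 rho F lam x `<=` thicken (F2 rho F lam y) (15 * (lam * fine (rho x y)))%R.
Proof.
move=> xy; pose y' : finite_class x := exist _ y xy.
rewrite (F2_class (class_self x)) (F2_class y') => p.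
exact: (refine2_lipschitz (@class_dist0 lam x) (@class_dist_sym lam x)
  (@tri x) (@cF x) (@class_four_points x)).
Qed.

Lemma alg_mapE x :
  alg_map rho F lam x = Defs.center (truncate (F2 rho F lam x)).
Proof.
rewrite /alg_map /alg_rect center_rect_hull//.
by apply: truncate_nonempty; [exact: F2_closed|exact: F2_nonempty].
Qed.

Lemma alg_map_in x : F x (alg_map rho F lam x).
Proof.
rewrite alg_mapE; apply: F2_sub; set S := truncate _.
suff [] : S (Defs.center S) by [].
apply: center_in.
- by apply: convexI; [exact: F2_convex|exact: convex_ball].
- by apply: compact_truncate; exact: F2_closed.
- by apply: truncate_nonempty; [exact: F2_closed|exact: F2_nonempty].
Qed.

Lemma alg_map_lipschitz x y :
  `|alg_map rho F lam x - alg_map rho F lam y|%:E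
    <= scale_dist (420 * lam) (rho x y).
Proof.
have [xy|xy] := pselect (rho x y < +oo); last first.
  move: xy; rewrite /scale_dist; case: ifP; first by rewrite leey.
  by move=> /negbT; rewrite -ltey => ->.
have fxy : rho x y \is a fin_num.
  by rewrite ge0_fin_numE// (pseudometric_ge0 hrho).
rewrite scale_dist_fin// lee_fin !alg_mapE; set d := (lam * fine (rho x y))%R.
have d0 : (0 <= d)%R.
  by rewrite mulr_ge0 ?lam_ge0// fine_ge0// (pseudometric_ge0 hrho).
have hxy := F2_hausdorff xy.
have hyx : F2 rho F lam y `<=` thicken (F2 rho F lam x) (15 * d)%R.
  by rewrite /d (pseudometric_sym hrho); apply: F2_hausdorff;
    rewrite (pseudometric_sym hrho).
have cl := F2_closed; have ne := F2_nonempty.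
apply: (@le_trans _ _ (10 * (15 * d))%R); last by rewrite -mulrA -/d; lra.
apply: center_lipschitz; try exact: compact_truncate;
  try exact: truncate_nonempty.
- by apply: truncate_hausdorff => //; exact: F2_convex.
- by apply: truncate_hausdorff => //; exact: F2_convex.
Qed.

Lemma alg_rect_bounded x : bounded_set (alg_rect rho F lam x).
Proof.
apply: compact_bounded; apply: compact_setX; apply: continuous_compact;
  try (by apply: compact_truncate; exact: F2_closed).
  by apply: continuous_subspaceT => p; exact: cvg_fst.
by apply: continuous_subspaceT => p; exact: cvg_snd.
Qed.

Lemma alg_rect_nonempty x : alg_rect rho F lam x !=set0.
Proof.
have [p Sp] := truncate_nonempty (@F2_closed x) (F2_nonempty x).
by exists p; split; exists p.
Qed.

End Selection.
End Pseudometric.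

Unset Implicit Arguments.
Local Open Scope ereal_scope.

Theorem theorem7p5 (R : realType) (M : finType) (rho : M -> M -> \bar R)
    (hrho : is_pseudometric rho)
    (T : set (set (plane R)))
    (hT : T = convex_compacts \/ T = closed_half_planes)
    (F : M -> set (plane R)) (hF : forall x, T (F x)) :
  (LambdaFP rho F = +oo ->
     (forall lam : R, iterative_algorithm rho F lam = NoGo) /\
     ~ exists f : M -> plane R, lipschitz_selection rho F [set: M]%SET f) /\
  (LambdaFP rho F <> +oo ->
     forall lam : R, LambdaFP rho F <= lam%:E ->
       iterative_algorithm rho F lam = Success (alg_map rho F lam) /\
       (forall x : M, F1 rho F lam x !=set0 /\ F2 rho F lam x !=set0) /\
       (forall x : M, alg_rect rho F lam x !=set0 /\
                      bounded_set (alg_rect rho F lam x)) /\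
       lipschitz_selection rho F [set: M]%SET (alg_map rho F lam) /\
       lip_norm rho [set: M]%SET (alg_map rho F lam) <= (420 * lam)%:E).
Proof.
split=> [Loo|Lfin lam hlam].
  split=> [lam|[f [fF]]]; first by rewrite /iterative_algorithm Loo eqxx.
  move=> /ereal_inf_lt[_ [l [l0 fl] <-]] _.
  suff : LambdaFP rho F <= l%:E by rewrite Loo leye_eq.
  apply: ereal_inf_lbound; exists l => //; split=> // S _; exists f.
  have lS : lip_norm rho S f <= l%:E.
    by apply: lip_norm_le => // x y _ _; apply: fl; rewrite inE.
  split=> //; split; last exact: le_lt_trans lS (ltry _).
  by move=> x _; apply: fF; rewrite inE.
have lS : lip_norm rho [set: M]%SET (alg_map rho F lam) <= (420 * lam)%:E.
  apply: lip_norm_le; first by rewrite mulr_ge0// (lam_ge0 hlam).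
  by move=> x y _ _; exact: (alg_map_lipschitz hrho hT hF hlam).
split; first by rewrite /iterative_algorithm; case: eqP.
split=> [x|].
  split; first exact: (F1_nonempty hrho hT hF hlam).
  exact: (F2_nonempty hrho hT hF hlam).
split=> [x|].
  split; first exact: (alg_rect_nonempty hrho hT hF hlam).
  exact: (alg_rect_bounded hrho hT hF hlam).
split=> //; split; last exact: le_lt_trans lS (ltry _).
by move=> x _; exact: (alg_map_in hrho hT hF hlam).
Qed.
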